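(* Let $X$ be a real Hilbert space, let $f\in C^{1,\omega}(X)$ be convex, and assume that $f$ is not affine. Let $$M=\sup_{x,y\in X,\,x\ne y}\frac{\|\nabla f(x)-\nabla f(y)\|}{\omega(\|x-y\|)}.$$ Then $(f,\nabla f)$ satisfies condition $(CW^{1,\omega})$ with constant $M>0$ on $E=X$, that is, $$f(x)\ge f(y)+\langle\nabla f(y),x-y\rangle+M\varphi^*\Big(\frac1M\|\nabla f(x)-\nabla f(y)\|\Big)\quad\text{for all }x,y\in X.$$
   Context: $\omega:[0,+\infty)\to[0,+\infty)$ is a concave, strictly increasing, continuous function with $\omega(0)=0$ and $\lim_{t\to+\infty}\omega(t)=+\infty$; $\varphi(t)=\int_0^t\omega(s)\,ds$ for $t\ge0$, and $\varphi^*(t)=\sup_{s\ge0}\{ts-\varphi(s)\}$ for $t\ge0$ is its Fenchel conjugate. $f\in C^{1,\omega}(X)$ means $f:X\to\mathbb{R}$ is differentiable and $\sup_{x\ne y}\frac{\|\nabla f(x)-\nabla f(y)\|}{\omega(\|x-y\|)}<\infty$. *)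

(* Defs.v *)
From HB Require Import structures.
From mathcomp Require Import all_boot all_order all_algebra.
From mathcomp Require Import all_classical all_reals all_analysis.
Set Implicit Arguments.
Unset Strict Implicit.
Unset Printing Implicit Defensive.
Import Order.TTheory GRing.Theory Num.Theory.
Import numFieldNormedType.Exports.
Local Open Scope classical_set_scope.
Local Open Scope ring_scope.

Definition concave_function (R : numFieldType) (E : lmodType R)
    (D : set (convex_lmodType E)) (g : convex_lmodType E -> R^o) : Prop :=
  convex_function D (fun x => - g x).

(* Functions on [0, +oo) are represented by functions on R of which only the
   values at nonnegative arguments are ever used. *)
Record is_modulus (R : realType) (omega : R -> R) : Prop := IsModulus {
  modulus_ge0 : forall t, 0 <= t -> 0 <= omega t;
  modulus_concave : concave_function (`[0, +oo[%classic : set R) omega;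
  modulus_increasing : {in `[0, +oo[ &, {homo omega : s t / s < t}};
  modulus_continuous : {within `[0, +oo[, continuous omega};
  modulus0 : omega 0 = 0;
  modulus_cvgy : omega t @[t --> +oo] --> +oo
}.

Definition modulus_primitive (R : realType) (omega : R -> R) (t : R) : R :=
  (\int[lebesgue_measure]_(s in `[0, t]) omega s)%R.

(* [sup] is real-valued and is 0 on unbounded sets; for the primitive of a
   modulus the supremum is finite because omega tends to +oo. *)
Definition fenchel_conjugate (R : realType) (phi : R -> R) (t : R) : R :=
  sup [set t * s - phi s | s in `[0, +oo[].

Definition affine_function (R : realType) (X : lmodType R) (f : X -> R) : Prop :=
  exists (L : {scalar X}) (c : R), forall x, f x = L x + c.

Section Gradient.
Context (R : realType) (X : completeNormedModType R).
Context (dotp : {dot X for (@idfun R)}).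

(* The Riesz representative of the Frechet differential; meaningful when f is
   differentiable at x and the norm of X is the one induced by dotp. *)
Definition gradient (f : X -> R) (x : X) : X :=
  get [set g : X | forall h : X, 'd f x h = dotp g h].

Definition gradient_ratios (omega : R -> R) (f : X -> R) : set R :=
  [set r | exists x y : X, x != y /\
     r = `|gradient f x - gradient f y| / omega `|x - y|].

Definition C1omega (omega : R -> R) (f : X -> R) : Prop :=
  (forall x, differentiable f x) /\ has_ubound (gradient_ratios omega f).

Definition gradient_modulus (omega : R -> R) (f : X -> R) : R :=
  sup (gradient_ratios omega f).

Definition CW1omega (omega : R -> R) (M : R) (E : set X)
    (f : X -> R) (G : X -> X) : Prop :=
  forall x y, E x -> E y ->
    f x >= f y + dotp (G y) (x - y)
         + M * fenchel_conjugate (modulus_primitive omega)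
                 (M^-1 * `|G x - G y|).

End Gradient.

(* Main.v *)
Require Import Defs.
From HB Require Import structures.
From mathcomp Require Import all_boot all_order all_algebra.
From mathcomp Require Import all_classical all_reals all_analysis.
From mathcomp Require Import ring lra.
Set Implicit Arguments.
Unset Strict Implicit.
Unset Printing Implicit Defensive.
Import Order.TTheory GRing.Theory Num.Theory.
Import numFieldNormedType.Exports.
Local Open Scope classical_set_scope.
Local Open Scope ring_scope.

(** The proof subtracts a tangent and takes a best descent step.  Fix [y]: since
    [f] is convex and differentiable, it lies above its tangent at [y]
    ([tangent_le]), so [g z = f z - f y - <grad f y, z - y>] is nonnegative.  The
    gradients of [g] and [f] differ by a constant, hence have the same bound
    [M omega] on their increments; integrating it along a unit direction [u]
    gives, for [s >= 0], [g (x + s u) <= g x + s <grad g x, u> + M phi s]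
    ([descent_lemma]).  For [u] opposite to [grad g x], nonnegativity at
    [x + s u] becomes [s |grad g x| - M phi s <= g x], and the supremum of the
    left-hand side over [s] is [M phi^* (|grad g x| / M)].  With
    [grad g x = grad f x - grad f y] this is the claim
    ([CW1omega_of_gradient_bound]).

    Were [M] nonpositive, the gradient of [f] would be constant, and the tangent
    inequalities between [x] and [0] in both directions would make [f] affine
    ([affine_of_constant_gradient]).

    The gradient represents the differential only by the Riesz theorem
    ([riesz_representation]), obtained here from completeness by minimising
    [|x|^2 - 2 L x]. *)

(** * Inner products and the Riesz representation theorem *)

Section InnerProduct.
Context (R : realType) (X : completeNormedModType R).
Context (dotp : {dot X for (@idfun R)}).
Hypothesis dotpE : forall x : X, dotp x x = `|x| ^+ 2.

Lemma dotpC u v : dotp u v = dotp v u.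
Proof. by rewrite hermC expr0 mul1r. Qed.

Lemma dotpZl a u v : dotp (a *: u) v = a * dotp u v.
Proof. exact: linearZl_LR. Qed.

Lemma dotpZr a u v : dotp u (a *: v) = a * dotp u v.
Proof. exact: linearZr_LR. Qed.

Lemma sqr_normD u v : `|u + v| ^+ 2 = `|u| ^+ 2 + 2 * dotp u v + `|v| ^+ 2.
Proof.
rewrite -!dotpE linearDl/= !linearDr/= (dotpC v u); ring.
Qed.

Lemma dotp_le_norm u v : dotp u v <= `|u| * `|v|.
Proof.
have [->|u0] := eqVneq u 0; first by rewrite linear0l normr0 mul0r.
have [->|v0] := eqVneq v 0; first by rewrite linear0r normr0 mulr0.
(* The combination that vanishes exactly in the equality case. *)
have : 0 <= `| `|v| *: u + (- `|u|) *: v | ^+ 2 by exact: sqr_ge0.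
rewrite sqr_normD dotpZl dotpZr !normrZ normrN !normr_id.
have uv0 : 0 < `|u| * `|v| by rewrite mulr_gt0// normr_gt0.
move=> ge0; rewrite -(ler_pM2l uv0); nra.
Qed.

(** If [L = <g, .>], then [J x = |x|^2 - 2 L x] equals [|x - g|^2 - |g|^2], so
    [g] can only be the minimiser of [J].  A minimising sequence is Cauchy by the
    parallelogram identity; at its limit the first variation of [J] vanishes. *)
Lemma riesz_representation (L : {linear X -> R}) : continuous L ->
  exists g, forall h, L h = dotp g h.
Proof.
move=> cL.
have [K [K0 LK]] : exists K : R, 0 < K /\ forall x, `|L x| <= K * `|x|.
  have := @linear_boundedP _ _ _ L; case=> + _.
  move=> /(_ (continuous_linear_bounded _ (cL 0))) /pinfty_ex_gt0[K K0 LK].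
  by exists K.
have LZ a x : L (a *: x) = a * L x by rewrite linearZ.
pose J (x : X) : R := `|x| ^+ 2 - 2 * L x.
have J_lb : has_lbound (range J).
  exists (- K ^+ 2) => _ [x _ <-]; rewrite /J.
  have := le_trans (ler_norm _) (LK x); have := sqr_ge0 (`|x| - K); nra.
have J0 : range J !=set0 by exists (J 0), 0.
pose m := inf (range J).
have mJ x : m <= J x by apply: ge_inf => //; exists x.
have JD x h t : J (x + t *: h) =
    J x + 2 * t * (dotp x h - L h) + t ^+ 2 * `|h| ^+ 2.
  rewrite /J sqr_normD dotpZr linearD LZ normrZ exprMn real_normK ?num_real//; ring.
have Jpar x y : J x + J y - 2 * J (2^-1 *: (x + y)) = `|x - y| ^+ 2 / 2.
  rewrite /J LZ (linearD L) normrZ gtr0_norm ?invr_gt0// exprMn.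
  have := sqr_normD x (- y); rewrite linearNr normrN => ->.
  by rewrite sqr_normD; field.
have /choice[u Ju] n : exists x, J x < m + n.+1%:R^-1.
  have [|_ [x _ <-] xm] := @inf_adherent _ _ (n.+1%:R^-1 : R) _ (conj J0 J_lb).
    by rewrite invr_gt0.
  by exists x.
have Jm : J (u n) @[n --> \oo] --> m.
  apply: (@squeeze_cvgr _ _ _ _ (cst m) (fun n => m + n.+1%:R^-1)).
  - by apply: nearW => n; rewrite mJ/= ltW.
  - exact: cvg_cst.
  - by rewrite -[X in _ --> X]addr0; apply: cvgD; [exact: cvg_cst|exact: cvg_harmonic].
have ucvg : cvg (u @ \oo).
  apply/cauchy_cvgP/cauchy_ballP => e e0.
  have /cvgrPdist_lt/(_ (e ^+ 2 / 4)) := Jm.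
  rewrite divr_gt0 ?exprn_gt0// => /(_ isT) Jme.
  pose A := [set x | `|m - J x| < e ^+ 2 / 4].
  (* The pairs of points nearly minimising J form a product of neighbourhoods
     along which the parallelogram identity bounds the distance. *)
  exists (A, A) => [|[x y] [/=]]; first by split.
  rewrite /A/= -!(distrC (J _)).
  move=> /(le_lt_trans (ler_norm _)) Jx /(le_lt_trans (ler_norm _)) Jy.
  rewrite -ball_normE /= -(@ltr_pXn2r _ 2)// ?nnegrE ?normr_ge0 ?(ltW e0)//.
  have := Jpar x y; have := mJ (2^-1 *: (x + y)); lra.
pose g := lim (u @ \oo); have ug : u @ \oo --> g := ucvg.
have Jg : J g = m.
  apply: (@cvg_unique _ (@Rhausdorff R) (J (u n) @[n --> \oo])) => //.
  apply: cvgB.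
  - by apply: cvgM; apply: cvg_norm.
  - by apply: cvgM; [exact: cvg_cst|apply: continuous_cvg => //; exact: cL].
exists g => h.
have [->|h0] := eqVneq h 0; first by rewrite linear0 linear0r.
set d := dotp g h - L h; have hh : 0 < `|h| ^+ 2 by rewrite exprn_gt0 ?normr_gt0.
(* The step minimises the quadratic t |-> 2 t d + t ^ 2 |h| ^ 2. *)
have := mJ (g + (- d / `|h| ^+ 2) *: h); rewrite JD Jg -/d.
have -> : m + 2 * (- d / `|h| ^+ 2) * d + (- d / `|h| ^+ 2) ^+ 2 * `|h| ^+ 2 =
    m - d ^+ 2 / `|h| ^+ 2 by field; rewrite normr_eq0.
rewrite lerDl oppr_ge0 pmulr_lle0 ?invr_gt0// => d0.
have /eqP : d ^+ 2 == 0 by rewrite eq_le d0 sqr_ge0.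
by move=> /eqP; rewrite sqrf_eq0 subr_eq0 => /eqP.
Qed.


(** * Gradients and tangents *)

Section Gradient.
Variable f : X -> R.
Hypothesis fdiff : forall x, differentiable f x.
Local Notation grad := (gradient dotp f).

Lemma diff_gradient (x h : X) : 'd f x h = dotp (grad x) h.
Proof.
have [g gP] := riesz_representation (diff_continuous (fdiff x)).
suff /getPex : exists g, [set g : X | forall h, 'd f x h = dotp g h] g by [].
by exists g.
Qed.

Lemma is_derive_line (x u : X) (t : R) :
  is_derive t (1 : R) (fun s : R => f (x + s *: u)) (dotp (grad (x + t *: u)) u).
Proof.
have dfu : is_derive (x + t *: u) u f (dotp (grad (x + t *: u)) u).
  by split; [exact: diff_derivable|rewrite deriveE// diff_gradient].
have E : (fun h : R => h^-1 *: ((f \o shift (x + t *: u)) (h *: u)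
           - f (x + t *: u))) =
         (fun h : R => h^-1 *: (((fun s : R => f (x + s *: u)) \o shift t) (h *: (1 : R))
           - f (x + t *: u))).
  by apply/funext => h /=; rewrite scalerDl addrCA [_ *: 1]mulr1.
case: dfu; rewrite /derivable /derive E => df1 df2.
by split.
Qed.

(** The difference quotients of a convex function along [y + h (x - y)], for
    [0 < h <= 1], are at most [f x - f y]; so is their limit at [0+]. *)
Lemma tangent_le (x y : X) : convex_function [set: X] f ->
  f y + dotp (grad y) (x - y) <= f x.
Proof.
move=> fcvx; rewrite -lerBrDl.
have [df] := is_derive_line y (x - y) 0; rewrite scale0r addr0 => <-.
apply: (cvgr_to_le (cvg_dnbhs_at_right df)).
near=> h; rewrite /= addr0 scale0r addr0 [h *: 1]mulr1.
have h0 : 0 < h by [].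
have h1 : h <= 1 by near: h; exact: nbhs_right_le.
rewrite -[_ *: _]/(h^-1 * _) ler_pdivrMl//.
have : f (h *: x + (1 - h) *: y) <= h * f x + (1 - h) * f y.
  by have := fcvx (Itv01 (ltW h0) h1) x y; rewrite !inE => /(_ I I).
have -> : h *: x + (1 - h) *: y = y + h *: (x - y).
  by rewrite scalerBr scalerBl scale1r addrCA addrA.
lra.
Unshelve. all: by end_near. Qed.

End Gradient.

End InnerProduct.

(** * The primitive of a modulus *)

Lemma modulus_gt0 (R : realType) (omega : R -> R) (t : R) :
  is_modulus omega -> 0 < t -> 0 < omega t.
Proof.
move=> omegaP t0; rewrite -(modulus0 omegaP).
by apply: (modulus_increasing omegaP) => //; rewrite in_itv/= ?lexx ?ltW.
Qed.

Section Modulus.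
Context (R : realType) (omega : R -> R).
Hypothesis omega_cont : {within `[0, +oo[, continuous omega}.
Hypothesis omega_ge0 : forall t, 0 <= t -> 0 <= omega t.
Local Notation phi := (modulus_primitive omega).

Lemma modulus_integrable b :
  (@lebesgue_measure R).-integrable `[0, b] (EFin \o omega).
Proof.
apply: continuous_compact_integrable; first exact: segment_compact.
apply: continuous_subspaceW omega_cont.
by move=> t /=; rewrite !in_itv/= andbT => /andP[].
Qed.

Lemma modulus_primitive0 : phi 0 = 0.
Proof. by rewrite /modulus_primitive set_itv1 Rintegral_set1. Qed.

Lemma modulus_primitive_ge0 t : 0 <= phi t.
Proof.
by apply: Rintegral_ge0 => s /=; rewrite in_itv/= => /andP[s0 _]; exact: omega_ge0.
Qed.

Lemma modulus_primitive_continuous b : 0 <= b ->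
  {within `[0, b], continuous phi}.
Proof.
by move=> b0; apply: parameterized_integral_continuous => //; exact: modulus_integrable.
Qed.

Lemma is_derive_modulus_primitive (t : R) : 0 < t -> is_derive t (1 : R) phi (omega t).
Proof.
move=> t0; have t1 : t < t + 1 by rewrite ltrDl.
have ct : {for t, continuous omega}.
  move: omega_cont => /continuous_within_itvcyP[+ _].
  by apply; rewrite in_itv/= t0.
have [dphi phi't] := continuous_FTC1_closed t1 (modulus_integrable (t + 1)) t0 ct.
by split; [exact: dphi|rewrite -derive1E; exact: phi't].
Qed.

End Modulus.

(** * Convex functions whose gradient is controlled by a modulus *)

Section Regularity.
Context (R : realType) (X : completeNormedModType R).
Context (dotp : {dot X for (@idfun R)}).
Hypothesis dotpE : forall x : X, dotp x x = `|x| ^+ 2.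
Context (omega : R -> R).
Hypothesis omegaP : is_modulus omega.
Context (f : X -> R).
Hypothesis fdiff : forall x, differentiable f x.
Local Notation phi := (modulus_primitive omega).
Local Notation grad := (gradient dotp f).
Context (M : R).
Hypothesis grad_le : forall x y, `|grad x - grad y| <= M * omega `|x - y|.

(** The left side minus the right side is nonincreasing in [s]: by
    Cauchy-Schwarz its derivative
    [<grad (x + s u) - grad x, u> - M omega s] is nonpositive. *)
Lemma descent_lemma (x u : X) (s : R) : `|u| = 1 -> 0 <= s ->
  f (x + s *: u) <= f x + s * dotp (grad x) u + M * phi s.
Proof.
move=> u1 s0.
pose d := dotp (grad x) u.
pose psi t := f (x + t *: u) - (d * t + M * phi t).
suff : psi s <= psi 0.
  by rewrite /psi modulus_primitive0 scale0r addr0 /d; lra.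
have dpsi (t : R) : 0 < t ->
    is_derive t (1 : R) psi (dotp (grad (x + t *: u)) u - (d + M * omega t)).
  move=> t0; apply: is_deriveB; first exact: is_derive_line.
  apply: is_deriveD.
    by apply: is_derive_eq; rewrite [_ *: _]mulr1.
  by apply: is_deriveZ; exact: (is_derive_modulus_primitive (modulus_continuous omegaP)).
move: s0; rewrite le_eqVlt => /predU1P[<-//|s0].
have cpsi : {within `[0, s], continuous psi}.
  have cline : {within `[0, s], continuous (fun t : R => f (x + t *: u))}.
    apply: continuous_subspaceT => t; apply: differentiable_continuous.
    by apply/derivable1_diffP; case: (is_derive_line dotpE fdiff x u t).
  have cphi := modulus_primitive_continuous (modulus_continuous omegaP) (ltW s0).
  move=> t; apply: cvgB; first exact: cline.
  apply: cvgD; apply: cvgM; [exact: cvg_cst| |exact: cvg_cst|exact: cphi].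
  by apply: continuous_subspaceT t => ?; exact: cvg_id.
have [t tI|c /itvP cI E] := @MVT R psi
    (fun t => dotp (grad (x + t *: u)) u - (d + M * omega t)) 0 s s0 _ cpsi.
  by apply: dpsi; rewrite (itvP tI).
rewrite -subr_le0 E mulr_le0_ge0 ?subr0 ?(ltW s0)//.
rewrite subr_le0 -lerBlDl /d -linearBl/=.
apply: le_trans (dotp_le_norm dotpE _ _) _; rewrite u1 mulr1.
have cu0 : x + c *: u - x = c *: u by rewrite addrC addKr.
by have := grad_le (x + c *: u) x; rewrite cu0 normrZ u1 mulr1 gtr0_norm ?cI.
Qed.

(** Each [s] in the supremum defining the conjugate comes from comparing the
    tangent at [y] with the descent lemma at [x], both evaluated at [x + s u],
    where [u] is the unit vector opposite to [grad x - grad y]. *)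
Lemma CW1omega_of_gradient_bound : 0 < M -> convex_function [set: X] f ->
  CW1omega dotp omega M [set: X] f grad.
Proof.
move=> M0 fcvx x y _ _; rewrite -lerBrDl mulrC -ler_pdivlMr//.
apply: ge_sup.
  exists (M^-1 * `|grad x - grad y| * 0 - phi 0), 0 => //=.
  by rewrite in_itv/= lexx.
move=> r [s /=]; rewrite in_itv/= andbT => s0 <-; rewrite ler_pdivlMr//.
have tan z := tangent_le dotpE fdiff z y fcvx.
have -> : (M^-1 * `|grad x - grad y| * s - phi s) * M =
    s * `|grad x - grad y| - M * phi s.
  by field; rewrite gt_eqF.
set v := grad x - grad y.
have [v0|v0] := eqVneq v 0.
  (* No direction to descend along: the term is - M phi s <= 0 and the tangent
     inequality suffices. *)
  rewrite v0 normr0 mulr0 sub0r (@le_trans _ _ 0)//.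
    rewrite oppr_le0 mulr_ge0 ?(ltW M0)//.
    exact: (modulus_primitive_ge0 (modulus_ge0 omegaP)).
  by rewrite subr_ge0 (le_trans _ (tan x)).
have nv0 : 0 < `|v| by rewrite normr_gt0.
pose u := - `|v|^-1 *: v.
have u1 : `|u| = 1 by rewrite normrZ normrN gtr0_norm ?invr_gt0// mulVf// gt_eqF.
have slope : dotp (grad x) u = dotp (grad y) u - `|v|.
  apply/eqP; rewrite -subr_eq0 opprB addrCA -linearBl/= -/v dotpZr dotpE.
  by rewrite expr2 mulNr mulKf ?subrr// gt_eqF.
have lower := tan (x + s *: u); have upper := descent_lemma x u1 s0.
have shift_arg : x + s *: u - y = (x - y) + s *: u by rewrite addrAC.
rewrite shift_arg linearDr/= dotpZr in lower.
rewrite slope mulrBr in upper.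
have arith : forall a b c d e p q : R,
    a + (b + c) <= d -> d <= e + (c - p) + q -> p - q <= e - (a + b).
  by clear; move=> *; lra.
exact: arith lower upper.
Qed.

End Regularity.

Section Affine.
Context (R : realType) (X : completeNormedModType R).
Context (dotp : {dot X for (@idfun R)}).
Hypothesis dotpE : forall x : X, dotp x x = `|x| ^+ 2.

Lemma affine_of_constant_gradient (f : X -> R) :
  (forall x, differentiable f x) -> convex_function [set: X] f ->
  (forall x, gradient dotp f x = gradient dotp f 0) -> affine_function f.
Proof.
move=> fdiff fcvx gradE; set a := gradient dotp f 0 in gradE.
pose g (x : X) : R := dotp a x.
have lin : scalar g by move=> k u v; rewrite /g linearDr/= dotpZr.
pose L : {scalar X} := HB.pack g (GRing.isLinear.Build _ _ _ _ g lin).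
exists L, (f 0) => x; rewrite -[L x]/(dotp a x).
apply: le_anti; apply/andP; split.
  have := tangent_le dotpE fdiff 0 x fcvx.
  by rewrite gradE sub0r linearNr lerBlDr addrC.
have := tangent_le dotpE fdiff x 0 fcvx.
by rewrite subr0 addrC.
Qed.

Lemma gradient_le_modulus (omega : R -> R) (f : X -> R) (x y : X) :
  is_modulus omega -> C1omega dotp omega f ->
  `|gradient dotp f x - gradient dotp f y| <=
    gradient_modulus dotp omega f * omega `|x - y|.
Proof.
move=> omegaP [_ ub].
have [->|xy] := eqVneq x y; first by rewrite !subrr !normr0 modulus0// mulr0.
rewrite -ler_pdivrMr; last first.
  by rewrite modulus_gt0// normr_gt0 subr_eq0.
by apply: ub_le_sup => //; exists x, y.
Qed.

End Affine.

Theorem proposition4p10 (R : realType) (X : completeNormedModType R)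
    (dotp : {dot X for (@idfun R)})
    (dotpE : forall x : X, dotp x x = `|x| ^+ 2)
    (omega : R -> R) (omegaP : is_modulus omega)
    (f : X -> R) (fC1 : C1omega dotp omega f)
    (fconvex : convex_function [set: X] f)
    (fNaffine : ~ affine_function f) :
  let M := gradient_modulus dotp omega f in
  0 < M /\ CW1omega dotp omega M [set: X] f (gradient dotp f).
Proof.
move=> M.
have [fdiff _] := fC1.
have grad_le x y := gradient_le_modulus x y omegaP fC1.
have M0 : 0 < M.
  rewrite ltNge; apply/negP => M0; apply: fNaffine.
  apply: (affine_of_constant_gradient dotpE fdiff fconvex) => x.
  apply/eqP; rewrite -subr_eq0 -normr_le0 (le_trans (grad_le _ _))//.
  by rewrite mulr_le0_ge0// (modulus_ge0 omegaP).
by split=> //; exact: CW1omega_of_gradient_bound.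
Qed.
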